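(* For a 2-block warehouse whose subaisles are indexed by $\{1,2,\dots,W_{sub}\}$ with $1$ the index of the topmost left subaisle, there exists an optimal walk that traverses every subaisle $i\in\{2,3,\dots,W_{sub}\}$ at most once.
   Context: **2-block warehouse.** A rectangular warehouse with $n\ge1$ parallel vertical picking aisles crossed by three horizontal cross-aisles. The part between two adjacent cross-aisles is a block, and the section of a picking aisle within a block is a subaisle, so there are $W_{sub}=2n$ subaisles. The artificial locations are the endpoints of subaisles, i.e. the crossings of aisles and cross-aisles. Finitely many picking locations (forming the set $V_L$) lie strictly inside the subaisles. The warehouse graph is undirected, with an edge between any two neighboring locations within a picking aisle and between any two neighboring artificial locations within a cross-aisle. Edge lengths are the (positive) distances; the layout is rectangular, so all subaisles of a block have the same length and the distance between two adjacent aisles is the same along every cross-aisle. The origin $s$ is the top-left artificial location (the northern endpoint of subaisle $1$). **Optimal walk.** Given a set $R\subseteq V_L$ of picking locations a picker has to visit, a picking walk is a closed walk in the warehouse graph that starts and ends at $s$ and visits every vertex of $R$ (vertices and edges may be repeated). It is optimal if its total length is minimum among such walks. The claim is for every such $R$. **Traversing** a subaisle means going (without reversing) from its northern artificial location to its southern artificial location or vice versa: each occurrence in the walk, as a consecutive subpath, of the straight path from one end of the subaisle to the other counts as one traversal. *)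

(* Defs.v *)
From HB Require Import structures.
From mathcomp Require Import all_boot all_order all_algebra.
From mathcomp Require Import reals.

Set Implicit Arguments.
Unset Strict Implicit.
Unset Printing Implicit Defensive.

Import Order.TTheory GRing.Theory Num.Theory.
Local Open Scope ring_scope.

(* The layout is drawn in the plane: aisle [a] is the vertical line of abscissa
   [aisle_x a], cross-aisle [c] the horizontal line of ordinate [cross_y c], with
   ordinates increasing southwards.  Hence the subaisles of a block all have the
   same length, and adjacent aisles are equally far apart on every cross-aisle. *)
Record warehouse (R : realType) := Warehouse {
  aisles : nat;
  aisles_gt0 : (0 < aisles)%N;
  aisle_x : 'I_aisles -> R;
  aisle_x_incr : forall a a' : 'I_aisles, (a < a')%N -> aisle_x a < aisle_x a';
  cross_y : 'I_3 -> R;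
  cross_y_incr : forall c c' : 'I_3, (c < c')%N -> cross_y c < cross_y c';
  loc : finType;
  loc_block : loc -> 'I_2;
  loc_aisle : loc -> 'I_aisles;
  loc_y : loc -> R;
  loc_inside : forall l : loc,
    cross_y (widen_ord (leqnSn 2) (loc_block l)) < loc_y l
      < cross_y (lift ord0 (loc_block l));
  loc_distinct : forall l l' : loc,
    loc_aisle l = loc_aisle l' -> loc_y l = loc_y l' -> l = l'
}.

Section Warehouse.
Variables (R : realType) (W : warehouse R).

(* [inl (c, a)] is the crossing of cross-aisle [c] and aisle [a]. *)
Definition vertex : finType := ('I_3 * 'I_(aisles W) + loc W)%type.

Definition vertex_aisle (v : vertex) : 'I_(aisles W) :=
  match v with inl ca => ca.2 | inr l => loc_aisle l end.

Definition vertex_y (v : vertex) : R :=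
  match v with inl ca => cross_y W ca.1 | inr l => loc_y l end.

Definition aisle_edge : rel vertex := fun u v =>
  [&& vertex_aisle u == vertex_aisle v, u != v &
   ~~ [exists w : vertex, (vertex_aisle w == vertex_aisle u) &&
        ((vertex_y u < vertex_y w < vertex_y v)
         || (vertex_y v < vertex_y w < vertex_y u))]].

Definition cross_edge : rel vertex := fun u v =>
  match u, v with
  | inl (c, a), inl (c', a') =>
      (c == c') && ((a'.+1 == a :> nat) || (a.+1 == a' :> nat))
  | _, _ => false
  end.

Definition edge : rel vertex := fun u v => aisle_edge u v || cross_edge u v.

(* One of the two summands vanishes when [u] and [v] are joined by an edge. *)
Definition edge_length (u v : vertex) : R :=
  `|aisle_x (vertex_aisle u) - aisle_x (vertex_aisle v)|
  + `|vertex_y u - vertex_y v|.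

Definition origin : vertex := inl (ord0, Ordinal (aisles_gt0 W)).

(* A walk from the origin is given by the sequence [p] of the vertices that come
   after the origin. *)
Definition picking_walk (A : {set loc W}) (p : seq vertex) : bool :=
  [&& path edge origin p, last origin p == origin &
   [forall l in A, (inr l : vertex) \in origin :: p]].

Definition walk_length (p : seq vertex) : R :=
  \sum_(e <- zip (origin :: p) p) edge_length e.1 e.2.

Definition optimal_walk (A : {set loc W}) (p : seq vertex) : Prop :=
  picking_walk A p /\
  forall p' : seq vertex, picking_walk A p' -> walk_length p <= walk_length p'.

Definition subaisle : finType := ('I_2 * 'I_(aisles W))%type.

Definition Wsub : nat := (2 * aisles W)%N.

Definition topmost_left : subaisle := (ord0, Ordinal (aisles_gt0 W)).

Definition subaisle_indexing (sub : nat -> subaisle) : Prop :=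
  (forall q : subaisle, exists! i : nat, (1 <= i <= Wsub)%N /\ sub i = q) /\
  sub 1%N = topmost_left.

Definition in_subaisle (q : subaisle) (v : vertex) : bool :=
  (vertex_aisle v == q.2) &&
  (cross_y W (widen_ord (leqnSn 2) q.1) <= vertex_y v
     <= cross_y W (lift ord0 q.1)).

(* The vertices of a subaisle, both ends included, from north to south. *)
Definition straight_path (q : subaisle) : seq vertex :=
  sort (fun u v : vertex => vertex_y u <= vertex_y v)
       [seq v <- enum vertex | in_subaisle q v].

Definition occurrences (t w : seq vertex) : nat :=
  count (fun k => prefix t (drop k w)) (iota 0 (size w)).

Definition traversals (p : seq vertex) (q : subaisle) : nat :=
  (occurrences (straight_path q) (origin :: p)
   + occurrences (rev (straight_path q)) (origin :: p))%N.

End Warehouse.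

(* Main.v *)
Require Import Defs.
From HB Require Import structures.
From mathcomp Require Import all_boot all_order all_algebra.
From mathcomp Require Import zify lra.
From mathcomp Require Import boolp reals.

Set Implicit Arguments.
Unset Strict Implicit.
Unset Printing Implicit Defensive.

Import Order.TTheory GRing.Theory Num.Theory.
Local Open Scope ring_scope.

(* A closed walk is traded for the multigraph of its edges: symmetric
   multiplicities, even degrees, the locations of [A] connected to the origin.
   By Euler's theorem every such multigraph is, near the origin, at least as long
   as some closed walk using no edge more often.  In a shortest multigraph
   multiplicities are at most 2 and no doubled edge lies on a cycle.  A subaisle
   can be traversed twice only if all its edges are doubled.

   Let [q] be such a doubled subaisle, [o] its end on the northernmost or
   southernmost cross-aisle.  If the cross edge from [o] to the next aisle is
   used, then replacing one copy of [q] and of that edge by the other two sides of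
   the rectangle (the middle cross edge and the neighbouring subaisle [q'])
   changes neither parities, nor connectivity, nor length.  If the cross edge was
   doubled, [q'] has not become doubled, since its edges lie on the rectangle, so
   there are fewer doubled subaisles.  Unless [o] is the origin, it is not a dead
   end, so the only other case is that of two single cross edges at [o]; after a
   flip to the right, either there are fewer doubled subaisles or [q'] is doubled
   and has no cross edge on its left at its outer end, hence by parity a doubled
   one on its right, and a second flip applies. *)

(** * Eulerian multigraphs *)

Section Multigraph.
Variable V : finType.
Implicit Types (m : V -> V -> nat) (w p : seq V) (u v x y z : V).

Definition steps w : seq (V * V) := zip w (behead w).

(** Both orientations are counted, so [mult w] is the undirected multigraph traced by [w]. *)
Definition mult w u v : nat :=
  (count_mem (u, v) (steps w) + count_mem (v, u) (steps w))%N.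

Definition supp m : rel V := fun u v => (0 < m u v)%N.

Definition deg m u : nat := (\sum_v m u v)%N.

(** The subtraction is truncated: this is an exchange of [w1] for [w2] only when [mult w1] is below
    [m]. *)
Definition swap m (w1 w2 : seq V) u v : nat :=
  (m u v - mult w1 u v + mult w2 u v)%N.

Lemma multC w u v : mult w u v = mult w v u.
Proof. by rewrite /mult addnC. Qed.

Lemma mult_cons2 x y p u v :
  mult (x :: y :: p) u v = (mult [:: x; y] u v + mult (y :: p) u v)%N.
Proof. by rewrite /mult /steps /= !addn0 addnACA. Qed.

Lemma mult_edge x y u v :
  mult [:: x; y] u v = (((x, y) == (u, v)) + ((x, y) == (v, u)))%N.
Proof. by rewrite /mult /= !addn0. Qed.

Lemma mult_cat x p p' u v :
  mult (x :: p ++ p') u v = (mult (x :: p) u v + mult (last x p :: p') u v)%N.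
Proof.
elim: p x => [|y p IHp] x /=; first by rewrite /mult /=; lia.
by rewrite mult_cons2 IHp [in RHS]mult_cons2 addnA.
Qed.

Lemma mult_gt0 w u v :
  (0 < mult w u v)%N = ((u, v) \in steps w) || ((v, u) \in steps w).
Proof. by rewrite /mult addn_gt0 -!has_count !has_pred1. Qed.

Lemma steps_mem w u v : (u, v) \in steps w -> (u \in w) && (v \in w).
Proof.
case: w => [|x p] //; elim: p x => [|y p IHp] x //=.
rewrite in_cons => /orP[/eqP[-> ->]|/IHp /andP[uin vin]].
  by rewrite !inE !eqxx orbT.
by rewrite !(in_cons x) uin vin !orbT.
Qed.

Lemma mult_mem w u v : (0 < mult w u v)%N -> (u \in w) && (v \in w).
Proof. by rewrite mult_gt0 => /orP[/steps_mem//|/steps_mem]; rewrite andbC. Qed.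

Lemma mult_uniq w u v : uniq w -> (mult w u v <= 1)%N.
Proof.
case: w => [|x p] //; elim: p x => [|y p IHp] x; first by rewrite /mult.
rewrite mult_cons2 mult_edge !xpair_eqE [uniq _]/= => /andP[xNp yp].
have [|/mult_mem/andP[uyp vyp]] := posnP (mult (y :: p) u v); last first.
  have [xNu xNv]: x != u /\ x != v.
    by split; apply: contraNneq xNp => ->.
  by rewrite (negPf xNu) (negPf xNv) IHp.
move=> ->; rewrite addn0.
move: xNp; rewrite inE negb_or => /andP[xNy _].
have [<-|_] := eqVneq x u; last by rewrite add0n leq_b1.
by rewrite [y == x]eq_sym (negPf xNy) andbF addn0 leq_b1.
Qed.

Lemma steps_rcons2 w y x :
  steps (rcons (rcons w y) x) = rcons (steps (rcons w y)) (y, x).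
Proof.
rewrite /steps; elim: w => [|z [|z' w] IHw] //=.
by move: IHw => /= ->.
Qed.

Lemma steps_rev w : steps (rev w) = rev [seq (e.2, e.1) | e <- steps w].
Proof.
case: w => [|x p] //; elim: p x => [|y p IHp] x //.
by rewrite !rev_cons steps_rcons2 -rev_cons IHp -rev_cons.
Qed.

Lemma mult_rev w u v : mult (rev w) u v = mult w u v.
Proof.
rewrite /mult steps_rev !count_rev !count_map addnC.
by congr addn; apply: eq_count => -[a b]; rewrite /= !xpair_eqE andbC.
Qed.

Lemma path_steps (e : rel V) x p :
  path e x p = all (fun uv => e uv.1 uv.2) (steps (x :: p)).
Proof. by elim: p x => [|y p IHp] x //=; rewrite IHp. Qed.

Lemma sum_deltar (P : V -> nat) y : (\sum_v (y == v) * P v)%N = P y.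
Proof.
rewrite (bigD1 y) //= eqxx mul1n big1 ?addn0 // => v.
by rewrite eq_sym => /negPf->.
Qed.

Lemma deg_mult_edge x y u : deg (mult [:: x; y]) u = ((x == u) + (y == u))%N.
Proof.
rewrite /deg; under eq_bigr do rewrite mult_edge !xpair_eqE -!mulnb.
rewrite big_split /= sum_deltar -big_distrr /=; congr addn.
by rewrite (bigD1 y) //= eqxx big1 ?muln1 ?addn0 // => v; rewrite eq_sym => /negPf->.
Qed.

(** Each passage through an inner vertex uses two edge ends, so only the two extremities can have
    odd degree, and they cancel when they coincide. *)
Lemma odd_deg_mult x p u :
  odd (deg (mult (x :: p)) u) = (x == u) (+) (last x p == u).
Proof.
elim: p x => [|y p IHp] x /=; first by rewrite addbb /deg big1.
have ->: deg (mult [:: x, y & p]) u =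
    (deg (mult [:: x; y]) u + deg (mult (y :: p)) u)%N.
  by rewrite /deg -big_split /=; apply: eq_bigr => v _; rewrite mult_cons2.
by rewrite oddD IHp deg_mult_edge oddD !oddb addbA addbK.
Qed.

Lemma degB m m' u : (forall v, (m' u v <= m u v)%N) ->
  deg (fun u v => (m u v - m' u v)%N) u = (deg m u - deg m' u)%N.
Proof. by move=> le; rewrite /deg sumnB. Qed.

Lemma odd_degB m m' u : (forall v, (m' u v <= m u v)%N) ->
  odd (deg (fun u v => (m u v - m' u v)%N) u) = odd (deg m u) (+) odd (deg m' u).
Proof. by move=> le; rewrite degB // oddB //; apply: leq_sum. Qed.

(* Hierholzer, without splicing: take a first step [x - y] and a maximal trail
   from [y], then prepend a maximal closed trail at [x] of what remains. *)
Lemma maximal_trail m x z :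
  (forall u v, m u v = m v u) -> (forall u, m u u = 0%N) ->
  (forall u, odd (deg m u) = (x == u) (+) (z == u)) ->
  exists p, [/\ last x p = z, forall u v, (mult (x :: p) u v <= m u v)%N &
    forall u v, u \in x :: p -> mult (x :: p) u v = m u v].
Proof.
have [n] := ubnP (\sum_u deg m u)%N.
elim: n m x z => // n IHn m x z len mC m0 mE.
have [y xy|x0] := pickP (supp m x); last first.
  have {}x0 v : m x v = 0%N by have := x0 v; rewrite /supp; case: (m x v).
  exists [::]; split=> // [|u v].
    (* No edge is left at [x]: its degree 0 is even, which forces [z = x]. *)
    by have := mE x; rewrite /deg big1 // eqxx /=; case: eqP.
  by rewrite inE => /eqP->; rewrite x0.
have xNy : x != y by apply/eqP => xy'; move: xy; rewrite /supp xy' m0.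
have le1 u v : (mult [:: x; y] u v <= m u v)%N.
  have [|] := posnP (mult [:: x; y] u v); first by move->.
  have := @mult_uniq [:: x; y] u v; rewrite /= inE xNy => /(_ isT) le gt0.
  apply: leq_trans le _; move: gt0; rewrite mult_gt0 !inE !xpair_eqE.
  by move=> /orP[] /andP[/eqP-> /eqP->] //; rewrite mC.
pose m1 u v := (m u v - mult [:: x; y] u v)%N.
have m1C u v : m1 u v = m1 v u by rewrite /m1 mC multC.
have m10 u : m1 u u = 0%N by rewrite /m1 m0.
have m1E u : odd (deg m1 u) = (y == u) (+) (z == u).
  rewrite /m1 odd_degB // mE deg_mult_edge oddD !oddb.
  by case: (x == u); case: (y == u); case: (z == u).
have m1len : (\sum_u deg m1 u < n)%N.
  apply: leq_trans (_ : \sum_u deg m u <= n)%N; last by rewrite -ltnS.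
  rewrite (bigD1 x) //= [leqRHS](bigD1 x) //= -addSn leq_add //; last first.
    by apply: leq_sum => u _; apply: leq_sum => v _; apply: leq_subr.
  rewrite degB // deg_mult_edge eqxx [y == x]eq_sym (negPf xNy) addn0 subn1.
  by rewrite prednK // /deg (bigD1 y) //= addn_gt0 [(0 < m x y)%N]xy.
have [p [lastp lep maxp]] := IHn _ _ _ m1len m1C m10 m1E.
pose m2 u v := (m1 u v - mult (y :: p) u v)%N.
have m2C u v : m2 u v = m2 v u by rewrite /m2 m1C multC.
have m20 u : m2 u u = 0%N by rewrite /m2 m10.
have m2E u : odd (deg m2 u) = (x == u) (+) (x == u).
  by rewrite /m2 odd_degB // m1E odd_deg_mult lastp !addbb.
have m2len : (\sum_u deg m2 u < n)%N.
  apply: leq_ltn_trans m1len; apply: leq_sum => u _; apply: leq_sum => v _.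
  exact: leq_subr.
have [p2 [lastp2 lep2 maxp2]] := IHn _ _ _ m2len m2C m20 m2E.
have multE u v : mult (x :: p2 ++ y :: p) u v =
    (mult (x :: p2) u v + (mult [:: x; y] u v + mult (y :: p) u v))%N.
  by rewrite mult_cat lastp2 mult_cons2.
have le12 u v := (le1 u v, lep u v, lep2 u v).
exists (p2 ++ y :: p); split=> [|u v|u v].
- by rewrite last_cat.
- by rewrite multE; case: (le12 u v) => -[]; rewrite /m2 /m1; lia.
(* On [x :: p2] the trail [p2] exhausts [m2], all that the rest has left; on [y :: p] the trail [p]
   exhausts [m1], so [m2] vanishes and [p2] adds nothing. *)
- rewrite -cat_cons mem_cat multE => /orP[/(maxp2 _ v)|/(maxp _ v)];
  by case: (le12 u v) => -[]; rewrite /m2 /m1; lia.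
Qed.

(** All edges at a vertex of a maximal trail are used by it, so a path of the support starting at
    [x] never leaves the trail. *)
Lemma closed_trail m x :
  (forall u v, m u v = m v u) -> (forall u, m u u = 0%N) ->
  (forall u, ~~ odd (deg m u)) ->
  exists p, [/\ last x p = x, forall u v, (mult (x :: p) u v <= m u v)%N &
    forall y, connect (supp m) x y -> y \in x :: p].
Proof.
move=> mC m0 mE; have [|p [lastp lep maxp]] := @maximal_trail m x x mC m0.
  by move=> u; rewrite addbb; apply/negbTE.
exists p; split=> // y /connectP[q].
elim/last_ind: q y => [|q u IHq] y; first by move=> _ ->; rewrite mem_head.
rewrite rcons_path last_rcons => /andP[xq qu] ->.
have /maxp mq := IHq _ xq erefl.
by move: qu; rewrite /supp -mq => /mult_mem/andP[].
Qed.

(** * Exchanging two paths with common ends *)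

Lemma swapC m w1 w2 : (forall u v, m u v = m v u) ->
  forall u v, swap m w1 w2 u v = swap m w1 w2 v u.
Proof. by move=> mC u v; rewrite /swap mC !(multC _ u). Qed.

(** Paths with the same two ends have the same odd-degree vertices, so the two parity changes
    cancel. *)
Lemma swap_even m x p1 p2 :
  (forall u v, (mult (x :: p1) u v <= m u v)%N) -> last x p1 = last x p2 ->
  (forall u, ~~ odd (deg m u)) ->
  forall u, ~~ odd (deg (swap m (x :: p1) (x :: p2)) u).
Proof.
move=> le12 last12 mE u.
rewrite /swap /deg big_split /= oddD -/(deg _ u) odd_degB //.
by rewrite -/(deg _ u) !odd_deg_mult -last12 (negPf (mE u)) addFb addbb.
Qed.

(** The map [r] allows a vertex to be contracted onto another one, as when a dead end is cut off. *)
Lemma connect_transfer (e e' : rel V) (r : V -> V) x y :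
  (forall u v, e u v -> connect e' (r u) (r v)) ->
  connect e x y -> connect e' (r x) (r y).
Proof.
move=> ee' /connectP[p xp ->]; elim: p x xp => //= z p IHp x /andP[xz zp].
exact: connect_trans (ee' _ _ xz) (IHp _ zp).
Qed.

Lemma connect_steps (e : rel V) x p :
  all (fun uv => e uv.1 uv.2) (steps (x :: p)) -> connect e x (last x p).
Proof. by rewrite -path_steps => xp; apply/connectP; exists p. Qed.

Lemma steps_split w u v : (u, v) \in steps w ->
  exists w1 w2, w = w1 ++ u :: v :: w2.
Proof.
case: w => [|x p] //; elim: p x => [|y p IHp] x //.
rewrite in_cons => /orP[/eqP[-> ->]|/IHp[w1 [w2 ->]]].
  by exists [::], p.
by exists (x :: w1), w2.
Qed.

End Multigraph.

(** * Geometry of the warehouse *)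

Section Geometry.
Variables (R : realType) (W : warehouse R).
Implicit Types (u v w x y : vertex W) (p : seq (vertex W)) (q : subaisle W).

Definition top_end q : vertex W := inl (widen_ord (leqnSn 2) q.1, q.2).
Definition bottom_end q : vertex W := inl (lift ord0 q.1, q.2).

Lemma cross_y_le (c c' : 'I_3) : (c <= c')%N -> cross_y W c <= cross_y W c'.
Proof.
rewrite leq_eqVlt => /orP[/eqP/val_inj-> //|cc'].
exact/ltW/cross_y_incr.
Qed.

(** Picking locations lie strictly inside blocks, hence never at the height of a cross-aisle. *)
Lemma vertex_y_inj u v :
  vertex_aisle u = vertex_aisle v -> vertex_y u = vertex_y v -> u = v.
Proof.
have loc_cross (l : loc W) c : loc_y l != cross_y W c.
  have /andP[lo hi] := loc_inside l; rewrite neq_lt.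
  have [cb|bc] := leqP c (widen_ord (leqnSn 2) (loc_block l)).
    by rewrite (le_lt_trans (cross_y_le cb) lo) orbT.
  have /cross_y_le ch : (lift ord0 (loc_block l) <= c)%N by [].
  by rewrite (lt_le_trans hi ch).
case: u v => [[c a]|l] [[c' a']|l'] /= aE.
- rewrite {}aE; have [cc'|cc'|/val_inj-> //] := ltngtP c c'.
    by move/eqP; rewrite lt_eqF // cross_y_incr.
  by move/eqP; rewrite gt_eqF // cross_y_incr.
- by move=> /eqP; rewrite eq_sym (negPf (loc_cross _ _)).
- by move=> /eqP; rewrite (negPf (loc_cross _ _)).
- by move=> yE; rewrite (loc_distinct aE yE).
Qed.

Lemma aisle_x_inj : injective (@aisle_x R W).
Proof.
move=> a a' aE; have [aa'|aa'|/val_inj //] := ltngtP a a';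
  by have := aisle_x_incr aa'; rewrite aE ltxx.
Qed.

Lemma edge_lengthC u v : edge_length u v = edge_length v u.
Proof. by rewrite /edge_length distrC [X in _ + X]distrC. Qed.

Lemma edge_length_gt0 u v : u != v -> 0 < edge_length u v.
Proof.
move=> uv; rewrite lt_neqAle eq_sym paddr_eq0 // !normr_eq0 !subr_eq0 addr_ge0 // andbT.
by apply: contraNN uv => /andP[/eqP/aisle_x_inj aE /eqP/vertex_y_inj->].
Qed.

Lemma edge_length_ge0 u v : 0 <= edge_length u v.
Proof. by rewrite addr_ge0. Qed.

Lemma aisle_edgeC u v : aisle_edge u v = aisle_edge v u.
Proof.
rewrite /aisle_edge eq_sym [u == v]eq_sym; case: eqP => //= ->; congr (_ && ~~ _).
by apply: eq_existsb => w; rewrite orbC.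
Qed.

Lemma cross_edgeC u v : cross_edge u v = cross_edge v u.
Proof.
by case: u v => [[c a]|l] [[c' a']|l'] //=; rewrite eq_sym orbC.
Qed.

Lemma edgeC u v : edge u v = edge v u.
Proof. by rewrite /edge aisle_edgeC cross_edgeC. Qed.

Lemma edge_irr u : edge u u = false.
Proof.
rewrite /edge /aisle_edge !eqxx /=.
by case: u => [[c a]|l] //=; rewrite eqxx orbb gtn_eqF.
Qed.

(** * Straight paths of subaisles *)

Lemma mem_straight q v : (v \in straight_path q) = in_subaisle q v.
Proof. by rewrite mem_sort mem_filter mem_enum andbT. Qed.

Lemma straight_uniq q : uniq (straight_path q).
Proof. by rewrite sort_uniq filter_uniq // enum_uniq. Qed.

Lemma straight_pairwise q :
  pairwise (fun u v => vertex_y u < vertex_y v) (straight_path q).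
Proof.
rewrite -sorted_pairwise; last by move=> u v w; apply: lt_trans.
rewrite -[sorted _ _](sorted_map (f := @vertex_y R W) (e' := <%R)) lt_sorted_uniq_le.
rewrite map_inj_in_uniq ?straight_uniq; last first.
  move=> u v; rewrite !mem_straight => /andP[/eqP ua _] /andP[/eqP va _].
  by apply: vertex_y_inj; rewrite ua.
rewrite sorted_map; apply: sort_sorted => u v; exact: le_total.
Qed.

Lemma top_in_subaisle q : in_subaisle q (top_end q).
Proof. by rewrite /in_subaisle /= !eqxx lexx cross_y_le //= leqnSn. Qed.

Lemma bottom_in_subaisle q : in_subaisle q (bottom_end q).
Proof. by rewrite /in_subaisle /= !eqxx lexx cross_y_le //= leqnSn. Qed.

Lemma straight_pathE q :
  exists p, straight_path q = top_end q :: rcons p (bottom_end q).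
Proof.
have := straight_pairwise q.
have := mem_straight q; have topq := top_in_subaisle q.
have botq := bottom_in_subaisle q.
have tb : vertex_y (top_end q) < vertex_y (bottom_end q).
  by apply: cross_y_incr.
case: (straight_path q) => [/(_ (top_end q))|x s]; first by rewrite topq.
move=> memx; rewrite pairwise_cons => /andP[/allP xs ss].
have xE : x = top_end q.
  have := memx (top_end q); rewrite topq in_cons => /orP[/eqP //|/xs].
  have := memx x; rewrite mem_head => /esym/andP[_ /andP[lo _]].
  by rewrite ltNge lo.
rewrite {}xE in memx xs *.
have := memx (bottom_end q); rewrite botq in_cons.
case: eqP => [bt|_ /=]; first by rewrite bt ltxx in tb.
case/lastP: s memx ss {xs} => // s z memz.
rewrite pairwise_rcons => /andP[/allP zs _].
rewrite mem_rcons in_cons => /orP[/eqP <-|/zs]; first by exists s.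
have := memz z; rewrite in_cons mem_rcons mem_head orbT => /esym/andP[_ /andP[_ hi]].
by rewrite ltNge hi.
Qed.

(** A vertex of the aisle strictly between [u] and [v] would belong to the subaisle, hence to the
    sorted list, where there is no room between two consecutive entries. *)
Lemma straight_step q u v : (u, v) \in steps (straight_path q) ->
  [/\ aisle_edge u v, in_subaisle q u, in_subaisle q v & vertex_y u < vertex_y v].
Proof.
move=> uv; have /andP[] := steps_mem uv; rewrite !mem_straight => uq vq.
have [s1 [s2 sE]] := steps_split uv.
have := straight_pairwise q; rewrite sE pairwise_cat.
case/and3P => /allrelP s1s _ /=; rewrite andbA.
move=> /andP[/andP[/andP[lt_uv _] /allP vs2] _].
split=> //; have /andP[/eqP ua /andP[ulo _]] := uq.
have /andP[/eqP va /andP[_ vhi]] := vq.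
rewrite /aisle_edge ua va eqxx /=; apply/andP; split.
  by apply: contraTneq lt_uv => ->; rewrite ltxx.
apply/existsP => -[w /andP[/eqP wa]].
case/orP => /andP[lt_uw lt_wv]; last first.
  by have := lt_trans (lt_trans lt_uw lt_wv) lt_uv; rewrite ltxx.
have : w \in straight_path q.
  by rewrite mem_straight /in_subaisle wa eqxx !ltW //
    ?(le_lt_trans ulo) // (lt_le_trans lt_wv).
rewrite sE mem_cat !in_cons => /orP[ws1|/or3P[/eqP wu|/eqP wv|ws2]].
- by have := s1s _ u ws1 (mem_head _ _); rewrite ltNge ltW.
- by rewrite wu ltxx in lt_uw.
- by rewrite wv ltxx in lt_wv.
- by have := vs2 _ ws2; rewrite ltNge ltW.
Qed.

Definition mid_end (a : 'I_(aisles W)) : vertex W :=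
  inl (lift ord0 (ord0 : 'I_2), a).

Definition outer_end q : vertex W :=
  inl (if q.1 == ord0 then ord0 else ord_max, q.2).

(* Directed away from the middle cross-aisle, so that both blocks look alike. *)
Definition block_path q : seq (vertex W) :=
  if q.1 == ord0 then rev (straight_path q) else straight_path q.

Lemma block_eq0 (b : 'I_2) : b != ord0 -> b = ord_max.
Proof. by case: b => [[|[|]]] // ltb _; apply/val_inj. Qed.

Lemma block_pathE q :
  exists p, block_path q = mid_end q.2 :: rcons p (outer_end q).
Proof.
have [p] := straight_pathE q; rewrite /block_path /top_end /bottom_end /outer_end.
case: q => b a /=; case: (eqVneq b ord0) => [->|/block_eq0->] ->.
  exists (rev p); rewrite rev_cons rev_rcons /mid_end.
  by congr (_ :: rcons _ (inl (_, _))); apply/val_inj.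
by exists p; congr (inl (_, _) :: rcons _ (inl (_, _))); apply/val_inj.
Qed.

Lemma mult_block q u v : mult (block_path q) u v = mult (straight_path q) u v.
Proof. by rewrite /block_path; case: ifP => // _; rewrite mult_rev. Qed.

Lemma block_uniq q : uniq (block_path q).
Proof. by rewrite /block_path; case: ifP => _; rewrite ?rev_uniq straight_uniq. Qed.

Lemma block_step q u v : (0 < mult (block_path q) u v)%N ->
  [/\ aisle_edge u v, in_subaisle q u & in_subaisle q v].
Proof.
rewrite mult_block mult_gt0 => /orP[] /straight_step[] // ? ? ? _.
by rewrite aisle_edgeC.
Qed.

(** Two subaisles of one aisle share only the crossing with the middle cross-aisle, whereas an edge
    has two distinct ends. *)
Lemma mult_block_inj q q' u v : (0 < mult (block_path q) u v)%N ->
  (0 < mult (block_path q') u v)%N -> q = q'.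
Proof.
move=> /block_step[/and3P[/eqP auv uv _] uq vq] /block_step[_ uq' vq'].
case: q q' uq vq uq' vq' => [b a] [b' a'].
have [<-|bb'] := eqVneq b b'.
  by move=> /andP[/eqP/= <- _] _ /andP[/eqP/= <- _].
suff yE c d : c != d :> 'I_2 -> in_subaisle (c, a) u -> in_subaisle (c, a) v ->
    in_subaisle (d, a') u -> in_subaisle (d, a') v -> vertex_y u = vertex_y v.
  by move=> uq vq uq' vq'; rewrite (vertex_y_inj auv (yE b b' _ _ _ _ _)) ?eqxx in uv.
have y01 w e e' : in_subaisle (ord0, e) w -> in_subaisle (ord_max, e') w ->
    vertex_y w = cross_y W (lift ord0 ord0).
  move=> /andP[_ /andP[_ /= hi]] /andP[_ /andP[/= lo _]].
  apply/le_anti/andP; split=> //; apply: le_trans lo.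
  by apply: cross_y_le.
have [->|/block_eq0->] := eqVneq c ord0; have [->|/block_eq0->] := eqVneq d ord0.
- by [].
- by move=> _ uc vc ud vd; rewrite (y01 _ _ _ uc ud) (y01 _ _ _ vc vd).
- by move=> _ uc vc ud vd; rewrite (y01 _ _ _ ud uc) (y01 _ _ _ vd vc).
- by [].
Qed.

Lemma vertex_y_bounds v : cross_y W ord0 <= vertex_y v <= cross_y W ord_max.
Proof.
case: v => [[c a]|l] /=; first by rewrite !cross_y_le //= -ltnS.
have /andP[lo hi] := loc_inside l.
rewrite (le_trans _ (ltW lo)) ?(le_trans (ltW hi)) ?cross_y_le //.
by rewrite -ltnS.
Qed.

(** The aisle does not extend beyond its outer end, so both neighbours lie on the same side of it;
    were they distinct, the nearer would separate the farther from the end. *)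
Lemma aisle_edge_outer q u v : aisle_edge (outer_end q) u ->
  aisle_edge (outer_end q) v -> u = v.
Proof.
move=> /and3P[/eqP au ou Nu] /and3P[/eqP av ov Nv].
have auv : vertex_aisle u = vertex_aisle v by rewrite -au.
apply: vertex_y_inj => //; apply/eqP.
have oy w : vertex_aisle (outer_end q) = vertex_aisle w -> outer_end q != w ->
    vertex_y (outer_end q) != vertex_y w.
  by move=> ow; apply: contraNN => /eqP/(vertex_y_inj ow)/eqP.
have {}ou := oy _ au ou; have {}ov := oy _ av ov.
move: Nu Nv; rewrite !negb_exists => /forallP/(_ v) + /forallP/(_ u).
rewrite -av au !auv !eqxx /= !negb_or.
have := vertex_y_bounds u; have := vertex_y_bounds v.
move: ou ov; rewrite /outer_end /=; case: ifP => _ ou ov.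
  move=> /andP[vlo _] /andP[ulo _] /andP[Nu _] /andP[Nv _].
  have {}ou : cross_y W ord0 < vertex_y u by rewrite lt_neqAle ou.
  have {}ov : cross_y W ord0 < vertex_y v by rewrite lt_neqAle ov.
  by move: Nu Nv; rewrite ou ov /= -!leNgt => uv vu; apply/eqP/le_anti/andP.
move=> /andP[_ vlo] /andP[_ ulo] /andP[_ Nu] /andP[_ Nv].
have {}ou : vertex_y u < cross_y W ord_max by rewrite lt_neqAle eq_sym ou.
have {}ov : vertex_y v < cross_y W ord_max by rewrite lt_neqAle eq_sym ov.
by move: Nu Nv; rewrite ou ov !andbT -!leNgt => uv vu; apply/eqP/le_anti/andP.
Qed.

(** The sum runs over ordered pairs, so every undirected edge counts twice; hence the factors [*+ 2]
    below. *)
Definition mlen (m : vertex W -> vertex W -> nat) : R :=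
  \sum_u \sum_v (m u v)%:R * edge_length u v.

Lemma mlen_mult p : mlen (mult p) = (\sum_(e <- steps p) edge_length e.1 e.2) *+ 2.
Proof.
have sumE (s : seq (vertex W * vertex W)) :
    \sum_u \sum_v (count_mem (u, v) s)%:R * edge_length u v =
    \sum_(e <- s) edge_length e.1 e.2.
  rewrite pair_bigA /=; elim: s => [|e s IHs].
    by rewrite big_nil big1 // => i _; rewrite mul0r.
  rewrite big_cons -IHs /= [in RHS](bigD1 e) //= [LHS](bigD1 e) //= addrA.
  rewrite -surjective_pairing eqxx natrD mulrDl mul1r; congr (_ + _).
  by apply: eq_bigr => i; rewrite -surjective_pairing eq_sym => /negPf->.
rewrite mulr2n -[in RHS]sumE /mlen [X in _ = _ + X]exchange_big -big_split /=.
apply: eq_bigr => u _; rewrite -big_split; apply: eq_bigr => v _ /=.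
by rewrite /mult natrD mulrDl [in X in _ = _ + X]edge_lengthC.
Qed.

Lemma mlen_swap m (w1 w2 : seq (vertex W)) : (forall u v, (mult w1 u v <= m u v)%N) ->
  mlen (swap m w1 w2) = mlen m - mlen (mult w1) + mlen (mult w2).
Proof.
move=> le1; rewrite /mlen -sumrB -big_split; apply: eq_bigr => u _ /=.
rewrite -sumrB -big_split; apply: eq_bigr => v _ /=.
by rewrite /swap natrD natrB // mulrDl mulrBl.
Qed.

(** The edge lengths telescope. Since the result depends on the block only, neighbouring subaisles
    of a block can be exchanged at no cost. *)
Lemma mlen_block q :
  mlen (mult (block_path q)) =
  (cross_y W (lift ord0 q.1) - cross_y W (widen_ord (leqnSn 2) q.1)) *+ 2.
Proof.
have -> : mlen (mult (block_path q)) = mlen (mult (straight_path q)).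
  by apply: eq_bigr => u _; apply: eq_bigr => v _; rewrite mult_block.
rewrite mlen_mult; congr (_ *+ 2).
have [p sE] := straight_pathE q.
have : {in steps (straight_path q), forall e : vertex W * vertex W,
    edge_length e.1 e.2 = vertex_y e.2 - vertex_y e.1}.
  move=> [u v] /straight_step[/and3P[/eqP auv _ _] _ _ uv] /=.
  by rewrite /edge_length auv subrr normr0 add0r distrC gtr0_norm // subr_gt0.
move=> lenE; rewrite (eq_big_seq _ lenE) sE.
have telescope x s : \sum_(e <- steps (x :: s)) (vertex_y e.2 - vertex_y e.1) =
    vertex_y (last x s) - vertex_y x.
  elim: s x => [|y s IHs] x /=; first by rewrite big_nil subrr.
  by rewrite big_cons -/(steps (y :: s)) IHs /= addrC addrA subrK.
by rewrite telescope last_rcons.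
Qed.

End Geometry.

(** * Shortest multigraphs *)

Section Optimal.
Variables (R : realType) (W : warehouse R) (A : {set loc W}).
Implicit Types (u v w x y : vertex W) (p : seq (vertex W)) (q : subaisle W).
Implicit Types m : vertex W -> vertex W -> nat.

Definition feasible m : Prop :=
  [/\ forall u v, m u v = m v u, forall u v, (0 < m u v)%N -> edge u v,
      forall u, ~~ odd (deg m u) &
      forall l, l \in A -> connect (supp m) (origin W) (inr l)].

Definition optimal m : Prop :=
  feasible m /\ forall m', feasible m' -> mlen m <= mlen m'.

Lemma feasible_irr m u : feasible m -> m u u = 0%N.
Proof.
by case=> _ mG _ _; case: (posnP (m u u)) => // /mG; rewrite edge_irr.
Qed.

(** Only the origin and the picking locations have to stay connected, so [r] may move the other
    crossings. *)
Lemma feasible_swap m x p1 p2 (r : vertex W -> vertex W) :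
  feasible m -> (forall u v, (mult (x :: p1) u v <= m u v)%N) ->
  last x p1 = last x p2 -> path (@edge R W) x p2 ->
  r (origin W) = origin W -> (forall l, r (inr l) = inr l) ->
  (forall u v, (0 < m u v)%N ->
     connect (supp (swap m (x :: p1) (x :: p2))) (r u) (r v)) ->
  feasible (swap m (x :: p1) (x :: p2)).
Proof.
move=> [mC mG mE mA] le1 last12 p2G rO rl rm; split.
- exact: swapC.
- move=> u v; rewrite /swap addn_gt0 subn_gt0 => /orP[uv|].
    by apply: mG; apply: leq_ltn_trans uv.
  rewrite mult_gt0; move: p2G; rewrite path_steps => /allP p2G.
  by case/orP => /p2G //=; rewrite edgeC.
- exact: swap_even.
- move=> l lA; rewrite -rO -(rl l); apply: connect_transfer rm _; exact: mA.
Qed.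

Lemma mult_return u v x y :
  mult [:: u; v; u] x y = (2 * mult [:: u; v] x y)%N.
Proof. by rewrite mult_cons2 -(mult_rev [:: v; u]) mul2n -addnn. Qed.

Lemma mult_edge_le1 u v x y : u != v -> (mult [:: u; v] x y <= 1)%N.
Proof. by move=> uv; apply: mult_uniq; rewrite /= inE uv. Qed.

Lemma mult_edge_gt0 u v x y : (0 < mult [:: u; v] x y)%N ->
  (x = u /\ y = v) \/ (x = v /\ y = u).
Proof.
by rewrite mult_gt0 !mem_seq1 !xpair_eqE => /orP[] /andP[/eqP-> /eqP->]; [left|right].
Qed.

(** Trading the detour [u, v, u] for the trivial walk at [u] drops two copies of an edge: parities
    survive and the length decreases strictly, so connectivity has to fail. *)
Lemma opt_no_return m u v (r : vertex W -> vertex W) :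
  optimal m -> (2 <= m u v)%N ->
  r (origin W) = origin W -> (forall l, r (inr l) = inr l) ->
  (forall x y, (0 < m x y)%N ->
     connect (supp (swap m [:: u; v; u] [:: u])) (r x) (r y)) -> False.
Proof.
move=> [mF mO] m2 rO rl rm.
have uv : u != v.
  by apply/eqP => uv; move: m2; rewrite uv (feasible_irr _ mF).
have le x y : (mult [:: u; v; u] x y <= m x y)%N.
  rewrite mult_return.
  have [->|gt0] := posnP (mult [:: u; v] x y); first by rewrite muln0.
  apply: leq_trans (_ : 2 * 1 <= _)%N; first by rewrite leq_pmul2l ?mult_edge_le1.
  by case: (mult_edge_gt0 gt0) => -[-> ->]; case: mF => // mC _ _ _; rewrite mC.
have /mO := @feasible_swap m u [:: v; u] [::] r mF le erefl isT rO rl rm.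
rewrite mlen_swap // !mlen_mult /steps /= !big_cons !big_nil mul0rn addr0.
have := edge_length_gt0 uv; rewrite /= mulr2n; have := edge_length_ge0 v u; lra.
Qed.

Lemma opt_le2 m u v : optimal m -> (m u v <= 2)%N.
Proof.
move=> mO; rewrite leqNgt; apply/negP => gt2.
have mC := let: And4 mC _ _ _ := mO.1 in mC.
have uv : u != v.
  by apply/eqP => uv; move: gt2; rewrite uv (feasible_irr _ mO.1).
apply: (@opt_no_return m u v id) => // [|x y xy]; first exact: ltnW.
apply: connect1; rewrite /supp /swap mult_return addn_gt0 subn_gt0.
have [->|gt0] := posnP (mult [:: u; v] x y); first by rewrite muln0 xy.
apply/orP; left; apply: (@leq_trans (2 * 1).+1).
  by rewrite ltnS leq_pmul2l ?mult_edge_le1.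
by case: (mult_edge_gt0 gt0) => -[-> ->]; rewrite // mC.
Qed.

(** The relation is the support without the edge [u - v]. If it still joined [u] to [v], both copies
    of that edge could be dropped. *)
Lemma opt_bridge m u v : optimal m -> (2 <= m u v)%N ->
  ~~ connect (fun x y => (0 < m x y)%N && (mult [:: u; v] x y == 0)%N) u v.
Proof.
move=> mO m2; apply/negP => uv.
have mC := let: And4 mC _ _ _ := mO.1 in mC.
pose e x y := (0 < m x y)%N && (mult [:: u; v] x y == 0)%N.
have eC : connect_sym e.
  by apply: sym_connect_sym => x y; rewrite /e mC multC.
have sub x y : connect e x y -> connect (supp (swap m [:: u; v; u] [:: u])) x y.
  apply: connect_sub => {}x {}y /andP[xy /eqP m0]; apply: connect1.
  by rewrite /supp /swap mult_return m0 subn0 ltn_addr.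
apply: (@opt_no_return m u v id) => // x y xy; apply: sub.
have [m0|gt0] := posnP (mult [:: u; v] x y).
  by apply: connect1; rewrite /e xy m0.
by case: (mult_edge_gt0 gt0) => -[-> ->]; rewrite // eC.
Qed.

(** An outer end other than the origin need not be visited, so both copies of its only edge can go;
    [r] contracts it onto [v]. *)
Lemma opt_no_dead_end q v m : optimal m ->
  outer_end q != origin W -> (2 <= m (outer_end q) v)%N ->
  (forall w, (0 < m (outer_end q) w)%N -> w = v) -> False.
Proof.
move=> mO oO m2 onlyv.
have mC := let: And4 mC _ _ _ := mO.1 in mC.
have ov : v != outer_end q.
  by apply/eqP => vo; move: m2; rewrite vo (feasible_irr _ mO.1).
pose r x := if x == outer_end q then v else x.
apply: (@opt_no_return m (outer_end q) v r) => //.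
- by rewrite /r eq_sym (negPf oO).
move=> x y xy; rewrite /r.
have [xo|xo] := eqVneq x (outer_end q).
  move: xy; rewrite xo => /onlyv ->; rewrite (negPf ov); exact: connect0.
have [yo|yo] := eqVneq y (outer_end q).
  by move: xy; rewrite yo mC => /onlyv ->; exact: connect0.
apply: connect1; rewrite /supp /swap mult_return.
have [->|/mult_edge_gt0[] [xE yE]] := posnP (mult [:: outer_end q; v] x y).
- by rewrite muln0 subn0 ltn_addr.
- by rewrite xE eqxx in xo.
- by rewrite yE eqxx in yo.
Qed.

(* Multiplicities are first reduced to 0, 1, 2 without changing parity nor
   support, which leaves finitely many multigraphs to compare. *)
Lemma opt_exists m0 : feasible m0 -> exists m, optimal m.
Proof.
move=> m0F.
pose cap k : 'I_3 := inord (if (k <= 2)%N then k else if odd k then 1 else 2).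
have capP k : [/\ (cap k <= k)%N, odd (cap k) = odd k & (0 < cap k)%N = (0 < k)%N].
  rewrite inordK; last by case: ifP => // _; case: ifP.
  by case: (leqP k 2) => // k2; case: ifP => ko; split; rewrite ?ko //; lia.
pose T := {ffun vertex W * vertex W -> 'I_3}.
pose g (f : T) u v : nat := f (u, v).
pose c m : T := [ffun uv => cap (m uv.1 uv.2)].
have gcE m u v : g (c m) u v = cap (m u v) by rewrite /g ffunE.
have cF m : feasible m -> feasible (g (c m)).
  move=> [mC mG mE mA]; split.
  - by move=> u v; rewrite !gcE mC.
  - by move=> u v; rewrite gcE; have [_ _ ->] := capP (m u v); exact: mG.
  - move=> u; suff -> : odd (deg (g (c m)) u) = odd (deg m u) by [].
    rewrite /deg; elim/big_rec2: _ => // v a b _ ab.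
    by rewrite !oddD ab gcE; have [_ -> _] := capP (m u v).
  - move=> l /mA; apply: connect_sub => u v uv; apply: connect1.
    by rewrite /supp gcE; have [_ _ ->] := capP (m u v).
have cle m : mlen (g (c m)) <= mlen m.
  apply: ler_sum => u _; apply: ler_sum => v _.
  apply: ler_wpM2r; first exact: edge_length_ge0.
  by rewrite ler_nat gcE; have [] := capP (m u v).
have P0 : `[< feasible (g (c m0)) >] by apply/asboolP; apply: cF.
have := @arg_minP _ R T (c m0) (fun f => `[< feasible (g f) >])
  (fun f => mlen (g f)) P0.
case=> f /asboolP fF fmin; exists (g f); split=> // m mF.
by apply: le_trans (cle m); apply: fmin; apply/asboolP; apply: cF.
Qed.

End Optimal.

(** * Flipping a doubled subaisle *)

Section Flip.
Variables (R : realType) (W : warehouse R) (A : {set loc W}).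
Implicit Types (u v w x y : vertex W) (p : seq (vertex W)) (q : subaisle W).
Implicit Types m : vertex W -> vertex W -> nat.

Definition doubled m q : bool :=
  [forall u, forall v, (0 < mult (block_path q) u v)%N ==> (2 <= m u v)%N].

Definition adjacent q q' : bool :=
  (q.1 == q'.1) && ((q'.2.+1 == q.2 :> nat) || (q.2.+1 == q'.2 :> nat)).

(** Both paths lead from [mid_end q.2] to [outer_end q'], along complementary halves of the
    rectangle. *)
Definition flip m q q' : vertex W -> vertex W -> nat :=
  swap m (rcons (block_path q) (outer_end q')) (mid_end q.2 :: block_path q').

Lemma doubledP m q : reflect
  (forall u v, (0 < mult (block_path q) u v)%N -> (2 <= m u v)%N) (doubled m q).
Proof.
apply: (iffP forallP) => [d u v uv|d u].
  by have /forallP/(_ v)/implyP := d u; exact.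
by apply/forallP => v; apply/implyP/d.
Qed.

Lemma adjacent_aisle q q' : adjacent q q' -> q.2 != q'.2.
Proof.
move=> /andP[_ adj]; apply/eqP => qq'; move: adj; rewrite qq'.
by rewrite orbb gtn_eqF.
Qed.

Lemma adjacent_cross q q' : adjacent q q' ->
  cross_edge (outer_end q) (outer_end q') /\ cross_edge (mid_end q.2) (mid_end q'.2).
Proof. by move=> /andP[/eqP bE adj]; rewrite /= bE !eqxx. Qed.

Lemma cross_neq u v : cross_edge u v -> u != v.
Proof.
move=> uv; apply: contraFneq (edge_irr v) => uE.
by rewrite /edge -[X in cross_edge X]uE uv orbT.
Qed.

Lemma outer_neq_mid q a : outer_end q != mid_end a.
Proof.
apply/eqP => -[/(congr1 val)/= cE _]; move: cE; by case: ifP.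
Qed.

Lemma mult_cross_aisle x y u v : vertex_aisle x != vertex_aisle y ->
  vertex_aisle u = vertex_aisle v -> mult [:: x; y] u v = 0%N.
Proof.
move=> xy uv; apply/eqP; rewrite -leqn0 leqNgt; apply/negP.
by move=> /mult_edge_gt0[] [xE yE]; rewrite xE yE in uv; rewrite uv eqxx in xy.
Qed.

(** An edge is vertical or horizontal according to whether its ends share an aisle; the two
    subaisles differ by aisle, the two cross edges by cross-aisle. As one inequality, this lets
    [lia] evaluate a flip edge by edge. *)
Lemma rectangle_disjoint q q' u v : adjacent q q' ->
  (mult (block_path q) u v + mult [:: outer_end q; outer_end q'] u v +
   mult [:: mid_end q.2; mid_end q'.2] u v + mult (block_path q') u v <= 1)%N.
Proof.
move=> /adjacent_aisle aN.
have := mult_uniq u v (block_uniq q); have := mult_uniq u v (block_uniq q').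
have [auv|auv] := eqVneq (vertex_aisle u) (vertex_aisle v).
  rewrite !mult_cross_aisle //.
  have [->|gt0 /[swap]] := posnP (mult (block_path q) u v); first by lia.
  have [->|gt0'] := posnP (mult (block_path q') u v); first by lia.
  by rewrite (mult_block_inj gt0 gt0') eqxx in aN.
have block0 q1 : mult (block_path q1) u v = 0%N.
  apply/eqP; rewrite -leqn0 leqNgt; apply: contraNN auv.
  by move=> /block_step[/and3P[]].
rewrite !block0 => _ _.
have oN : outer_end q != outer_end q' by apply: contraNneq aN => -[_ ->].
have mN : mid_end q.2 != mid_end q'.2 by apply: contraNneq aN => -[->].
have := mult_edge_le1 u v oN; have := mult_edge_le1 u v mN.
have [->|/mult_edge_gt0 uvE] := posnP (mult [:: outer_end q; outer_end q'] u v);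
  first by lia.
have [->|/mult_edge_gt0 uvE'] := posnP (mult [:: mid_end q.2; mid_end q'.2] u v);
  first by lia.
by case: uvE uvE' => -[-> _] [] [/eqP]; rewrite (negPf (outer_neq_mid _ _)).
Qed.

Lemma flipE m q q' u v : flip m q q' u v =
  (m u v - (mult (block_path q) u v + mult [:: outer_end q; outer_end q'] u v) +
   (mult [:: mid_end q.2; mid_end q'.2] u v + mult (block_path q') u v))%N.
Proof.
rewrite /flip /swap; have [p' ->] := block_pathE q'; have [p ->] := block_pathE q.
rewrite rcons_cons -cats1 mult_cat last_rcons.
by rewrite (mult_cons2 (mid_end q.2) (mid_end q'.2)).
Qed.

Lemma mult_edgeE x y : x != y -> mult [:: x; y] x y = 1%N.
Proof.
move=> xy; rewrite mult_edge eqxx xpair_eqE [y == x]eq_sym (negPf xy) andbF.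
by [].
Qed.

Lemma connect_block (e : rel (vertex W)) q :
  (forall u v, (0 < mult (block_path q) u v)%N -> e u v) ->
  connect e (mid_end q.2) (outer_end q).
Proof.
move=> Be; have [p qE] := block_pathE q.
have := @connect_steps _ e (mid_end q.2) (rcons p (outer_end q)).
rewrite last_rcons; apply; apply/allP => -[u v] uv.
by apply: Be; rewrite qE mult_gt0 uv.
Qed.

Lemma mlenD m m' : mlen (fun u v => (m u v + m' u v)%N) = mlen m + mlen m'.
Proof.
rewrite /mlen -big_split; apply: eq_bigr => u _; rewrite -big_split.
by apply: eq_bigr => v _ /=; rewrite natrD mulrDl.
Qed.

Lemma flip_opt m q q' : optimal A m -> doubled m q -> adjacent q q' ->
  (0 < m (outer_end q) (outer_end q'))%N -> optimal A (flip m q q').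
Proof.
move=> [mF mO] /doubledP mq adj qq'.
have [mC _ _ _] := mF.
have disj u v := rectangle_disjoint u v adj.
have le1 u v : (mult (block_path q) u v +
    mult [:: outer_end q; outer_end q'] u v <= m u v)%N.
  have := disj u v; have [->|/mq] := posnP (mult (block_path q) u v); last by lia.
  have [->//|/[dup] gt0 /mult_edge_gt0 uvE ?] :=
    posnP (mult [:: outer_end q; outer_end q'] u v).
  suff : (0 < m u v)%N by lia.
  by case: uvE => -[-> ->] //; rewrite mC.
have flip_block u v : (0 < mult (block_path q) u v)%N -> (0 < flip m q q' u v)%N.
  by move=> gt0; rewrite flipE; have := mq _ _ gt0; have := disj u v; lia.
have [oE mE] := adjacent_cross adj.
(* The outer cross edge may have been used up. The way round goes through the remaining copy of [q],
   the middle cross edge and [q']. *)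
have oo' : connect (supp (flip m q q')) (outer_end q) (outer_end q').
  have fC : connect_sym (supp (flip m q q')).
    by apply: sym_connect_sym => u v; rewrite /supp /flip swapC.
  apply: (connect_trans (y := mid_end q.2)).
    by rewrite fC; apply: connect_block.
  apply: (connect_trans (y := mid_end q'.2)); last first.
    by apply: connect_block => u v gt0; rewrite /supp flipE; lia.
  by apply: connect1; rewrite /supp flipE mult_edgeE ?cross_neq //; lia.
have fF : feasible A (flip m q q').
  rewrite /flip; have [p' q'E] := block_pathE q'; have [p qE] := block_pathE q.
  have leE u v : (mult (mid_end q.2 :: rcons (rcons p (outer_end q)) (outer_end q'))
      u v <= m u v)%N.
    by have := le1 u v; rewrite qE -[rcons (rcons _ _) _]cats1 mult_cat last_rcons.
  rewrite qE q'E; apply: (feasible_swap (r := id)) => //.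
  - by rewrite /= !last_rcons.
  - rewrite /= {1}/edge mE orbT path_steps -q'E; apply/allP => -[u v] uv /=.
    have /block_step[e _ _] : (0 < mult (block_path q') u v)%N.
      by rewrite mult_gt0 uv.
    by rewrite /edge e.
  move=> u v uv; suff : connect (supp (flip m q q')) u v by rewrite /flip qE q'E.
  have := disj u v; have := le1 u v.
  have [B0|/flip_block ?] := posnP (mult (block_path q) u v); last first.
    by move=> _ _; apply: connect1.
  have [O0|/mult_edge_gt0 uvE _ _] :=
      posnP (mult [:: outer_end q; outer_end q'] u v); last first.
    case: uvE => -[-> ->] //; rewrite sym_connect_sym // => x y.
    by rewrite /supp /flip swapC.
  by move=> _ _; apply: connect1; rewrite /supp flipE B0 O0; lia.
(* The flip preserves length, as opposite sides of the rectangle are equally long. *)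
split=> // m' /mO; apply: le_trans.
pose s1 := rcons (block_path q) (outer_end q').
pose s2 := mid_end q.2 :: block_path q'.
have s1E u v : mult s1 u v = (mult (block_path q) u v +
    mult [:: outer_end q; outer_end q'] u v)%N.
  have [p qE] := block_pathE q.
  by rewrite /s1 qE rcons_cons -cats1 mult_cat last_rcons.
have s2E u v : mult s2 u v = (mult [:: mid_end q.2; mid_end q'.2] u v +
    mult (block_path q') u v)%N.
  by rewrite /s2; have [p' ->] := block_pathE q'; rewrite mult_cons2.
rewrite mlen_swap -/s1 => [|u v]; last by rewrite s1E.
have eqlen (f g : vertex W -> vertex W -> nat) :
    (forall u v, f u v = g u v) -> mlen f = mlen g.
  by move=> fg; apply: eq_bigr => u _; apply: eq_bigr => v _; rewrite fg.
rewrite (eqlen _ _ s1E) (eqlen _ _ s2E) !(mlenD (mult _) (mult _)) !mlen_block.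
move: adj => /andP[/eqP bE _].
rewrite !mlen_mult /steps /= !big_cons !big_nil /edge_length /= -bE !subrr !normr0.
by lra.
Qed.

(** Multiplicities are at most 2, so losing one copy leaves fewer than two on each edge of [q]; its
    first edge is a witness. *)
Lemma flip_self m q q' : optimal A m -> doubled m q -> adjacent q q' ->
  doubled (flip m q q') q = false.
Proof.
move=> mO /doubledP mq adj; apply/negP => /doubledP fq.
have [p qE] := block_pathE q.
have [v qv] : exists v, (0 < mult (block_path q) (mid_end q.2) v)%N.
  by exists (head (outer_end q) p); rewrite qE mult_gt0; case: (p) => [|x s] /=;
    rewrite mem_head.
have := fq _ _ qv; have := opt_le2 (mid_end q.2) v mO.
by rewrite flipE; have := rectangle_disjoint (mid_end q.2) v adj; lia.
Qed.

Lemma flip_other m q q' q1 : adjacent q q' -> q1 != q -> q1 != q' ->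
  doubled (flip m q q') q1 = doubled m q1.
Proof.
move=> adj q1q q1q'.
have fE u v : (0 < mult (block_path q1) u v)%N -> flip m q q' u v = m u v.
  move=> gt0; rewrite flipE.
  have B0 q2 : q1 != q2 -> mult (block_path q2) u v = 0%N.
    move=> q12; apply/eqP; rewrite -leqn0 leqNgt; apply: contraNN q12 => gt2.
    by rewrite (mult_block_inj gt0 gt2).
  have [/and3P[/eqP auv _ _] _ _] := block_step gt0.
  by rewrite !B0 // !mult_cross_aisle ?(adjacent_aisle adj) // subn0 !addn0.
by apply/idP/idP => /doubledP d; apply/doubledP => u v uv; have := d u v uv;
  rewrite fE.
Qed.

Definition ndoubled m : nat := #|[set q | doubled m q]|.

(** [q] leaves the set of doubled subaisles, and only [q'] can enter it. *)
Lemma flip_ndoubled m q q' : optimal A m -> doubled m q -> adjacent q q' ->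
  (ndoubled (flip m q q') <= ndoubled m)%N.
Proof.
move=> mO mq adj; rewrite /ndoubled [leqRHS](cardsD1 q) inE mq.
apply: leq_trans (_ : #|q' |: ([set q1 | doubled m q1] :\ q)| <= _)%N; last first.
  by rewrite cardsU1 leq_add2r leq_b1.
apply: subset_leq_card; apply/subsetP => q1; rewrite !inE.
have [//|q1q'] := eqVneq q1 q'; have [->|q1q] := eqVneq q1 q.
  by rewrite (flip_self mO).
by rewrite flip_other.
Qed.

Lemma flip_ndoubled_lt m q q' : optimal A m -> doubled m q -> adjacent q q' ->
  ~~ doubled (flip m q q') q' -> (ndoubled (flip m q q') < ndoubled m)%N.
Proof.
move=> mO mq adj fq'; apply: proper_card; apply/properP; split.
  apply/subsetP => q1; rewrite !inE.
  have [->|q1q'] := eqVneq q1 q'; first by rewrite (negPf fq').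
  have [->//|q1q] := eqVneq q1 q; by rewrite flip_other.
by exists q; rewrite inE // (flip_self mO).
Qed.

(** After the flip all four sides of the rectangle are still used. A doubled [q'] would thus have
    its last edge, from [z] to [outer_end q'], doubled and on a cycle, against [opt_bridge]. *)
Lemma flip_doubled_edge m q q' : optimal A m -> doubled m q -> adjacent q q' ->
  (2 <= m (outer_end q) (outer_end q'))%N ->
  optimal A (flip m q q') /\ (ndoubled (flip m q q') < ndoubled m)%N.
Proof.
move=> mO mq adj m2; have fO := flip_opt mO mq adj (ltnW m2); split=> //.
apply: flip_ndoubled_lt => //; apply/negP => /doubledP fq'.
have [p' q'E] := block_pathE q'.
pose z := last (mid_end q'.2) p'.
have disj u v := rectangle_disjoint u v adj.
have zo u v : (mult [:: z; outer_end q'] u v <= mult (block_path q') u v)%N.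
  by rewrite q'E -cats1 mult_cat leq_addl.
have /fq' f2 : (0 < mult (block_path q') z (outer_end q'))%N.
  by apply: leq_trans (zo z (outer_end q')); rewrite /mult /= eqxx.
have := opt_bridge fO f2; set e := (fun x y => _) => /negP; apply.
have eC : connect_sym e.
  apply: sym_connect_sym => x y; rewrite /e multC.
  by case: fO => -[-> _ _ _] _.
(* The rest of the cycle: from [z] back along [q'], then the middle cross edge, [q], and the outer
   cross edge. *)
apply: (connect_trans (y := mid_end q'.2)).
  rewrite eC; apply: connect_steps; apply/allP => -[u v] uv /=.
  have Buv : (0 < mult (block_path q') u v)%N.
    by rewrite q'E -cats1 mult_cat addn_gt0 mult_gt0 uv.
  have := fq' _ _ Buv; rewrite /e => /ltnW-> /=.
  rewrite -leqn0 leqNgt; apply/negP => /mult_edge_gt0 uvE.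
  have := block_uniq q'; rewrite q'E -rcons_cons rcons_uniq => /andP[+ _].
  have /andP[uin vin] := steps_mem uv.
  by case: uvE => -[uE vE]; rewrite -?uE -?vE ?uin ?vin.
have [oE mE] := adjacent_cross adj.
apply: (connect_trans (y := mid_end q.2)).
  rewrite eC; apply: connect1; rewrite /e flipE.
  have := disj (mid_end q.2) (mid_end q'.2).
  have := zo (mid_end q.2) (mid_end q'.2); rewrite mult_edgeE ?cross_neq //.
  by move=> ? ?; apply/andP; split; lia.
apply: (connect_trans (y := outer_end q)).
  apply: connect_block => u v Buv; rewrite /e flipE; have := disj u v.
  by move: mq => /doubledP/(_ _ _ Buv); have := zo u v => ? ? ?; apply/andP; split; lia.
apply: connect1; rewrite /e flipE; have := disj (outer_end q) (outer_end q').
have := zo (outer_end q) (outer_end q'); rewrite mult_edgeE ?cross_neq //.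
by move=> ? ?; apply/andP; split; lia.
Qed.

End Flip.

(** * Removing doubled subaisles *)

Section Reduction.
Variables (R : realType) (W : warehouse R) (A : {set loc W}).
Implicit Types (u v w x y : vertex W) (p : seq (vertex W)) (q : subaisle W).
Implicit Types m : vertex W -> vertex W -> nat.

(* Both maps fix an aisle that has no neighbour on the given side. *)
Definition right_of q : subaisle W := (q.1, insubd q.2 q.2.+1).
Definition left_of q : subaisle W := (q.1, insubd q.2 q.2.-1).

Lemma adjacent_sides q q' : adjacent q q' -> q' = left_of q \/ q' = right_of q.
Proof.
case: q q' => [b a] [b' a'] /andP[/eqP/= <- /orP[/eqP aE|/eqP aE]]; [left|right];
  congr (_, _); apply/val_inj; rewrite val_insubd /=.
  by rewrite -aE /= ltn_ord.
by rewrite aE ltn_ord.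
Qed.

Lemma left_right q : adjacent q (right_of q) -> left_of (right_of q) = q.
Proof.
case: q => [b a]; rewrite /adjacent /left_of /right_of /= eqxx /= val_insubd.
case: ifP => [lt_a _|_]; last by rewrite orbb gtn_eqF.
by congr (_, _); apply/val_inj; rewrite val_insubd /= val_insubd lt_a /= ltn_ord.
Qed.

Lemma edge_outer q v : edge (outer_end q) v ->
  aisle_edge (outer_end q) v \/ exists2 q', adjacent q q' & v = outer_end q'.
Proof.
rewrite /edge => /orP[|]; first by left.
case: v => [[c a]|l] //= /andP[/eqP <- adj]; right.
by exists (q.1, a); rewrite // /adjacent eqxx.
Qed.

Lemma outer_edge_adjacent q q' :
  q'.1 = q.1 -> edge (outer_end q) (outer_end q') -> adjacent q q'.
Proof.
move=> bE /orP[/and3P[/eqP/= aE + _]|/andP[_ adj]].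
  by rewrite /outer_end bE aE eqxx.
by rewrite /adjacent bE eqxx.
Qed.

(** At the outer end only the doubled aisle edge and the edge towards [q0] can be used. The latter
    is used because there is no dead end, and its multiplicity is not 1 because the degree is
    even. *)
Lemma doubled_outer m q q0 : optimal A m -> doubled m q ->
  outer_end q != origin W -> q0.1 = q.1 ->
  (forall q', adjacent q q' -> q' != q0 -> m (outer_end q) (outer_end q') = 0%N) ->
  adjacent q q0 /\ m (outer_end q) (outer_end q0) = 2%N.
Proof.
move=> mO /doubledP mq oO bE only0.
have [[mC mG mE _] _] := mO.
have [p qE] := block_pathE q; pose z := last (mid_end q.2) p.
have zo : (0 < mult (block_path q) (outer_end q) z)%N.
  by rewrite qE multC -cats1 mult_cat addn_gt0 orbC mult_gt0 mem_head.
have m2 : m (outer_end q) z = 2%N.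
  by apply/eqP; rewrite eqn_leq (opt_le2 _ _ mO) mq.
have [oz _ _] := block_step zo.
have nbr v : (0 < m (outer_end q) v)%N ->
    v = z \/ adjacent q q0 /\ v = outer_end q0.
  move=> /[dup] mv /mG/edge_outer[ov|[q' adj vE]].
    by left; apply: aisle_edge_outer ov oz.
  right; have [<-//|q'q0] := eqVneq q' q0.
  by rewrite vE (only0 _ adj q'q0) in mv.
have [w0|w_gt0] := posnP (m (outer_end q) (outer_end q0)).
  case: (opt_no_dead_end mO oO (leq_trans _ (eq_leq (esym m2)))) => // v mv.
  by case: (nbr v mv) => // -[_ vE]; rewrite vE w0 in mv.
have adj := outer_edge_adjacent bE (mG _ _ w_gt0).
have q0z : outer_end q0 != z.
  apply: contraNneq (adjacent_aisle adj) => q0z.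
  by case/and3P: oz => /eqP/= ->; rewrite -q0z.
split=> //; apply/eqP; rewrite eqn_leq (opt_le2 _ _ mO) ltn_neqAle w_gt0 andbT.
apply: contraNneq (mE (outer_end q)) => w1.
rewrite /deg (bigD1 z) //= (bigD1 (outer_end q0)) //= m2 -w1 big1 // => v.
move=> /andP[vz v0]; apply/eqP; rewrite -leqn0 leqNgt; apply/negP.
by move=> /nbr[/eqP|[_ /eqP]]; apply/negP.
Qed.

(** Distinct subaisles have distinct outer ends, and that of [topmost_left] is the origin; this is
    where the exception for subaisle 1 comes from. *)
Lemma outer_neq_origin q : q != topmost_left W -> outer_end q != origin W.
Proof.
apply: contraNneq; case: q => b a; rewrite /outer_end /origin /= => -[bE aE].
by move: bE; rewrite aE; have [->|_] := eqVneq b ord0.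
Qed.

Lemma right_neq_topmost q : adjacent q (right_of q) -> right_of q != topmost_left W.
Proof.
move=> adj; apply/eqP => -[_ /(congr1 val)].
move: adj => /adjacent_aisle; rewrite /= val_insubd.
case: ifP => // lt_n /eqP[]; apply/val_inj.
by rewrite val_insubd lt_n.
Qed.

Lemma fewer_doubled m q : optimal A m -> doubled m q -> q != topmost_left W ->
  exists2 m', optimal A m' & (ndoubled m' < ndoubled m)%N.
Proof.
move=> mO mq /outer_neq_origin oO; have [[mC mG _ _] _] := mO.
have step m1 q1 q2 : optimal A m1 -> doubled m1 q1 ->
    adjacent q1 q2 /\ m1 (outer_end q1) (outer_end q2) = 2%N ->
    exists2 m', optimal A m' & (ndoubled m' < ndoubled m1)%N.
  move=> m1O m1q [adj m2]; exists (flip m1 q1 q2);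
  by case: (flip_doubled_edge m1O m1q adj); rewrite ?m2.
(* Without a cross edge on the right, the left one is doubled and a flip to the left decreases the
   count. *)
have [r0|r_gt0] := posnP (m (outer_end q) (outer_end (right_of q))).
  apply: (step m q (left_of q) mO mq); apply: doubled_outer => //.
  by move=> q' /adjacent_sides[->|->] //; rewrite eqxx.
have adj : adjacent q (right_of q) by apply: outer_edge_adjacent (mG _ _ r_gt0).
have [r2|r1] := leqP 2 (m (outer_end q) (outer_end (right_of q))).
  apply: (step m q (right_of q)) => //; split=> //.
  by apply/eqP; rewrite eqn_leq r2 (opt_le2 _ _ mO).
have fO := flip_opt mO mq adj r_gt0.
have [fq|fq] := boolP (doubled (flip m q (right_of q)) (right_of q)); last first.
  by exists (flip m q (right_of q)) => //; apply: flip_ndoubled_lt mO mq adj fq.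
(* The cross edge had multiplicity exactly 1 and the flip consumed it, so the new doubled subaisle
   can only have its edge on the right. *)
have f0 : flip m q (right_of q) (outer_end (right_of q)) (outer_end q) = 0%N.
  case: fO => -[fC _ _ _] _; rewrite fC flipE.
  have := rectangle_disjoint (outer_end q) (outer_end (right_of q)) adj.
  by rewrite mult_edgeE ?cross_neq ?(adjacent_cross adj).1 //; lia.
have [|m' m'O lt_m'] := step _ _ (right_of (right_of q)) fO fq.
  have rO := outer_neq_origin (right_neq_topmost adj).
  apply: (@doubled_outer _ _ (right_of (right_of q)) fO fq rO erefl).
  by move=> q' /adjacent_sides[->|->]; [rewrite (left_right adj) f0 | case/eqP].
by exists m' => //; apply: leq_trans lt_m' (flip_ndoubled mO mq adj).
Qed.

Lemma opt_not_doubled m0 : feasible A m0 ->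
  exists2 m, optimal A m & forall q, q != topmost_left W -> ~~ doubled m q.
Proof.
move=> /opt_exists[m mO].
have [n] := ubnP (ndoubled m); elim: n m mO => // n IHn m mO lt_n.
have [/existsP[q /andP[qN mq]]|/existsPn noq] :=
    boolP [exists q, (q != topmost_left W) && doubled m q].
  have [m' m'O lt_m'] := fewer_doubled mO mq qN.
  by apply: IHn m'O _; apply: leq_trans lt_m' _; rewrite -ltnS.
by exists m => // q qN; have := noq q; rewrite qN.
Qed.

(** * Existence of a feasible multigraph, and passage between multigraphs and walks *)

Lemma connect_edge_origin v : connect (@edge R W) (origin W) v.
Proof.
have eC : connect_sym (@edge R W) by apply/sym_connect_sym/edgeC.
have top_row a : connect (@edge R W) (origin W) (inl (ord0, a)).
  case: a => k; elim: k => [|k IHk] lt_k.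
    suff -> : inl (ord0, Ordinal lt_k) = origin W by exact: connect0.
    by congr (inl (_, _)); apply/val_inj.
  apply: connect_trans (IHk (ltnW lt_k)) (connect1 _).
  by rewrite /edge /= !eqxx !orbT.
have block_edge q u w : (0 < mult (block_path q) u w)%N -> edge u w.
  by move=> /block_step[e _ _]; rewrite /edge e.
have mid a : connect (@edge R W) (origin W) (mid_end a).
  apply: connect_trans (top_row a) _; rewrite eC.
  exact: (connect_block (q := (ord0, a)) (block_edge _)).
have sub q x : in_subaisle q x -> connect (@edge R W) (origin W) x.
  rewrite -mem_straight => xq; apply: connect_trans (mid q.2) _.
  have {}xq : x \in block_path q by rewrite /block_path; case: ifP; rewrite ?mem_rev.
  have [p qE] := block_pathE q; rewrite qE in xq.
  apply: (path_connect (p := rcons p (outer_end q))) xq.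
  rewrite path_steps -qE; apply/allP => -[y w] yw; apply: (block_edge q).
  by rewrite mult_gt0 yw.
case: v => [[c a]|l]; last first.
  by apply: (sub (loc_block l, loc_aisle l)); rewrite /in_subaisle /= eqxx;
    case/andP: (loc_inside l) => /ltW-> /ltW->.
(* Cross-aisles 0 and 1 bound the northern block; cross-aisle 2 is reached through the southern
   one. *)
have [c0|c0] := leqP c 1; first apply: (sub (ord0, a)); last apply: (sub (ord_max, a)).
  by rewrite /in_subaisle /= eqxx !cross_y_le.
rewrite /in_subaisle /= eqxx !cross_y_le //; first exact: (leq_ord c).
exact: ltnW.
Qed.

Lemma feasible_exists : feasible A (fun u v => 2 * edge u v)%N.
Proof.
split.
- by move=> u v; rewrite edgeC.
- by move=> u v; case: (edge u v).
- by move=> u; rewrite /deg -big_distrr oddM.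
- move=> l _; move: (connect_edge_origin (inr l)); apply: connect_sub => u v uv.
  by apply: connect1; rewrite /supp uv.
Qed.

Lemma walk_feasible p : picking_walk A p -> feasible A (mult (origin W :: p)).
Proof.
move=> /and3P[Gp /eqP lastp /forall_inP Ap]; split.
- exact: multC.
- move=> u v; rewrite mult_gt0; move: Gp; rewrite path_steps => /allP Gp.
  by case/orP => /Gp //=; rewrite edgeC.
- by move=> u; rewrite odd_deg_mult lastp addbb.
- move=> l /Ap; apply: path_connect; rewrite path_steps; apply/allP => -[u v] uv.
  by rewrite /supp /= mult_gt0 uv.
Qed.

Lemma mlen_walk p : mlen (mult (origin W :: p)) = walk_length p *+ 2.
Proof. by rewrite mlen_mult. Qed.

(** The closed trail extracted from [m] is no longer than [m], and the multigraph of any picking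
    walk is no shorter than [m]. *)
Lemma optimal_walk_exists m : optimal A m ->
  exists2 p, optimal_walk A p & forall u v, (mult (origin W :: p) u v <= m u v)%N.
Proof.
move=> [mF mO]; have [mC mG mE mA] := mF.
have [p [lastp lep Vp]] :=
  closed_trail (origin W) mC (fun u => feasible_irr u mF) mE.
exists p => //; split.
  apply/and3P; split; first 1 last.
  - by apply/eqP.
  - by apply/forall_inP => l /mA/Vp.
  rewrite path_steps; apply/allP => -[u v] uv; apply: mG.
  by apply: leq_trans (lep u v); rewrite mult_gt0 uv.
move=> p' /walk_feasible/mO; rewrite mlen_walk => lep'.
rewrite -(ler_pMn2r (n := 2)) // -mlen_walk; apply: le_trans lep'.
apply: ler_sum => u _; apply: ler_sum => v _.
by rewrite ler_wpM2r ?edge_length_ge0 // ler_nat.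
Qed.

(** Every occurrence of [t] contains the step from [u] to [v] at the same offset [size t1], so
    shifting positions by that offset is injective. *)
Lemma occurrences_step (t w : seq (vertex W)) u v : (u, v) \in steps t ->
  (occurrences t w <= count_mem (u, v) (steps w))%N.
Proof.
move=> /steps_split[t1 [t2 ->]].
have stepE : count_mem (u, v) (steps w) = occurrences [:: u; v] w.
  rewrite /occurrences; elim: w => [|x w IHw] //.
  rewrite [size _]/= -[(size w).+1]/(1 + size w)%N iotaD (iotaDl 1 0) count_cat.
  rewrite count_map /= addn0 -IHw; case: w {IHw} => [|y w]; first by rewrite andbF.
  by rewrite /= prefix0s andbT xpair_eqE !(eq_sym u) !(eq_sym v).
rewrite {}stepE /occurrences -!size_filter -(size_map (addn (size t1))).
apply: uniq_leq_size.
  by rewrite map_inj_uniq ?filter_uniq ?iota_uniq //; apply: addnI.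
move=> _ /mapP[k + ->]; rewrite !mem_filter !mem_iota /= add0n.
move=> /andP[/prefixP[s wE] _].
have dropE : drop (size t1 + k) w = u :: v :: t2 ++ s.
  by rewrite -drop_drop wE -catA drop_size_cat.
rewrite dropE /= !eqxx prefix0s /= ltnNge; apply/negP => /drop_oversize.
by rewrite dropE.
Qed.

(** Southward and northward traversals use the edge in opposite directions, matching the two
    summands of [mult]. *)
Lemma traversals_mult p q u v : (0 < mult (straight_path q) u v)%N ->
  (traversals p q <= mult (origin W :: p) u v)%N.
Proof.
have stepC (x y : vertex W) : ((x, y) \in steps (rev (straight_path q))) =
    ((y, x) \in steps (straight_path q)).
  rewrite steps_rev mem_rev; apply/mapP/idP => [[[a b] ab [-> ->]] //|yx].
  by exists (y, x).
rewrite /traversals mult_gt0 /mult => /orP[] uv.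
  by apply: leq_add; apply: occurrences_step; rewrite ?stepC.
by rewrite addnC; apply: leq_add; apply: occurrences_step; rewrite ?stepC.
Qed.

End Reduction.

Theorem theorem5p6 (R : realType) (W : warehouse R)
    (sub : nat -> subaisle W) (sub_indexing : subaisle_indexing sub)
    (A : {set loc W}) :
  exists p : seq (vertex W),
    optimal_walk A p /\
    forall i : nat, (2 <= i <= Wsub W)%N -> (traversals p (sub i) <= 1)%N.
Proof.
have [m mO md] := opt_not_doubled (feasible_exists A).
have [p pO lep] := optimal_walk_exists mO.
exists p; split=> // i /andP[i2 iW].
have iN : sub i != topmost_left W.
  apply/eqP => subi; have [/(_ (topmost_left W))[j [_ j_uniq]] sub1] := sub_indexing.
  have : j = i by apply: j_uniq; rewrite iW (ltnW i2).
  have -> : j = 1%N by apply: j_uniq; rewrite (leq_trans _ iW) ?(ltnW i2).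
  by move=> i1; rewrite -i1 in i2.
(* A subaisle that is not doubled has an edge of multiplicity at most 1, which bounds its
   traversals. *)
have := md _ iN; rewrite negb_forall => /existsP[u].
rewrite negb_forall => /existsP[v]; rewrite negb_imply -ltnNge ltnS mult_block.
move=> /andP[uv m1]; apply: leq_trans (traversals_mult p uv) _.
exact: leq_trans (lep u v) m1.
Qed.
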